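(* Let $M$ be a compact Kähler manifold or a compact co-Kähler manifold, with metric $g$, isostatistically embedded as a submanifold of $(\mathcal{P}(\Xi^{N}),g^{F},T^{A-C})$. Then $M$ is not a $\nabla^{0}$-totally geodesic submanifold of $\mathcal{P}(\Xi^{N})$, where $\nabla^0$ is the Levi-Civita connection of the Fisher metric $g^F$.
   Context: $\mathcal{P}(\Xi^N)$ is the space of strictly positive probability distributions on a sample space; for compact manifolds the paper takes the sample space finite with $N+1$ elements, so that $\mathcal{P}(\Xi^N)$ is the open simplex $\Delta^{N}=\{p\in\mathbb{R}^{N+1}:p_i>0,\ \sum_{i=1}^{N+1}p_i=1\}$. The Fisher metric is $g^F_{ij}=E_{p}(\partial_i\log p\,\partial_j\log p)$ and the Amari–Chentsov tensor is $T^{A-C}_{ijk}=E_p(\partial_i\log p\,\partial_j\log p\,\partial_k\log p)$. A smooth embedding $i:(M,g,T)\to(N',h,K)$ between manifolds with a Riemannian metric and a totally symmetric 3-tensor is isostatistical if $g=i^*h$ and $T=i^*K$. On a Kähler (resp. co-Kähler) manifold the tensor used is $T(X,Y,Z)=g(\nabla^*_XY-\nabla_XY,Z)$ for a pair $(\nabla,\nabla^* )$ of torsion-free linear connections that are dual with respect to $g$ (i.e. $X\,g(Y,Z)=g(\nabla_XY,Z)+g(Y,\nabla^*_XZ)$) and satisfy $\nabla\Omega=0$ (resp. $\nabla\Omega=0$, $\nabla E=0$), where $\Omega$ is the Kähler form (resp. the structure 2-form). A co-Kähler manifold is $(M^{2d+1},\Omega,\alpha)$ with $\Omega$ a closed 2-form,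 $\alpha$ a closed 1-form, $\alpha\wedge\Omega^d$ nowhere zero, admitting a compatible almost contact metric structure $(\Theta,E,\alpha,g)$ with $N^{\Theta}=0$. Here $i_E\Omega=0$, $i_E\alpha=1$; $\Theta^2=-I+\alpha\otimes E$, $\Theta E=0$, $\alpha\circ\Theta=0$, $\alpha=g(\cdot,E)$, $g=\Omega(\cdot,\Theta\cdot)+\alpha\otimes\alpha$; and $N^{\Theta}(X,Y)=[\Theta X,\Theta Y]-\Theta[\Theta X,Y]-\Theta[X,\Theta Y]+\Theta^2[X,Y]$. Manifolds are without boundary. *)

(* Defs.v *)
From HB Require Import structures.
From mathcomp Require Import all_boot all_order all_algebra all_fingroup.
From mathcomp Require Import all_classical all_reals all_analysis.

Set Implicit Arguments.
Unset Strict Implicit.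
Unset Printing Implicit Defensive.

Import Order.TTheory GRing.Theory Num.Theory.
Import numFieldNormedType.Exports.

Local Open Scope classical_set_scope.
Local Open Scope ring_scope.

Section SmoothMaps.
Context {R : realType} {n : nat}.

(* [Ck k U f]: the partial derivatives of [f] of order at most [k] exist and
   are continuous on the open set [U]. *)
Fixpoint Ck (V : normedModType R) (k : nat) (U : set 'rV[R]_n)
    (f : 'rV[R]_n -> V) : Prop :=
  (forall x, U x -> {for x, continuous f}) /\
  (if k is k'.+1 then
     forall j : 'I_n, (forall x, U x -> derivable f x (delta_mx 0 j)) /\
                      Ck k' U (fun x => 'D_(delta_mx 0 j) f x)
   else True).

Definition smooth_on (V : normedModType R) (U : set 'rV[R]_n)
  (f : 'rV[R]_n -> V) : Prop := forall k, Ck k U f.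

End SmoothMaps.

(* Smooth n-manifolds without boundary.  [cinv i] is the inverse of the chart
   [cmap i]; only its values on [cmap i @` cdom i] are meaningful.  The atlas
   need not be maximal. *)
Record manifold (R : realType) (n : nat) := Manifold {
  mpoint :> topologicalType;
  chart : Type;
  cdom : chart -> set mpoint;
  cmap : chart -> mpoint -> 'rV[R]_n;
  cinv : chart -> 'rV[R]_n -> mpoint;
  mpoint_hausdorff : hausdorff_space mpoint;
  mpoint_second_countable : @second_countable mpoint;
  cdom_open : forall i, open (cdom i);
  cdom_cover : forall p, exists i, cdom i p;
  crange_open : forall i, open (cmap i @` cdom i);
  cmapK : forall i p, cdom i p -> cinv i (cmap i p) = p;
  cmap_continuous : forall i p, cdom i p -> {for p, continuous (cmap i)};
  cinv_continuous :
    forall i x, (cmap i @` cdom i) x -> {for x, continuous (cinv i)};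
  ctrans_smooth : forall i j,
    smooth_on ((cmap i @` cdom i) `&` (cinv i @^-1` cdom j))
              (cmap j \o cinv i) }.

Arguments chart {R n}.
Arguments cdom {R n m} i.
Arguments cmap {R n m} i.
Arguments cinv {R n m} i.

Section LocalFields.
Context {R : realType}.

Definition mform (n k : nat) := ('I_k -> 'rV[R]_n) -> R.

(* A covariant [k]-tensor field on an open set of R^n: [T x v] is the value at
   the point [x] on the vectors [v 0], ..., [v (k - 1)]. *)
Definition ctensor (n k : nat) := 'rV[R]_n -> mform n k.

Definition ev1 n (T : ctensor n 1) x u := T x (tnth [tuple u]).
Definition ev2 n (T : ctensor n 2) x u v := T x (tnth [tuple u; v]).
Definition ev3 n (T : ctensor n 3) x u v w := T x (tnth [tuple u; v; w]).

Definition pullback n m k (F : 'rV[R]_n -> 'rV[R]_m) (T : ctensor m k) :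
  ctensor n k := fun x v => T (F x) (fun l => 'D_(v l) F x).

Definition multilinear n k (t : mform n k) : Prop :=
  forall (l : 'I_k) (v : 'I_k -> 'rV[R]_n) (a : R) (u w : 'rV[R]_n),
    t (dfwith v l (a *: u + w)) = a * t (dfwith v l u) + t (dfwith v l w).

Definition alternating n k (t : mform n k) : Prop :=
  forall (v : 'I_k -> 'rV[R]_n) (l m : 'I_k), l != m -> v l = v m -> t v = 0.

Definition symmetric_form n k (t : mform n k) : Prop :=
  forall (s : 'S_k) (v : 'I_k -> 'rV[R]_n), t (v \o s) = t v.

Definition wedge n k l (s : mform n k) (t : mform n l) : mform n (k + l) :=
  fun v => ((k`! * l`!)%N%:R)^-1 *
    \sum_(p : 'S_(k + l)) (-1) ^+ odd_perm p *
      s (fun a => v (p (lshift l a))) * t (fun b => v (p (rshift k b))).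

Fixpoint wedge_pow n (t : mform n 2) (d : nat) : mform n (d * 2) :=
  if d is d'.+1 return mform n (d * 2) then wedge t (@wedge_pow n t d')
  else fun=> 1.

(* The exterior derivative, evaluated on constant vector fields (whose Lie
   brackets vanish). *)
Definition ext_deriv n k (T : ctensor n k) : ctensor n k.+1 := fun x v =>
  \sum_(l < k.+1) (-1) ^+ l *
    'D_(v l) (fun y => T y (fun a => v (lift l a))) x.

Definition lie_bracket n (X Y : 'rV[R]_n -> 'rV[R]_n) (x : 'rV[R]_n) :
  'rV[R]_n := 'D_(X x) Y x - 'D_(Y x) X x.

Definition app n (A : 'rV[R]_n -> 'rV[R]_n -> 'rV[R]_n)
  (X : 'rV[R]_n -> 'rV[R]_n) : 'rV[R]_n -> 'rV[R]_n := fun x => A x (X x).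

Definition nijenhuis n (A : 'rV[R]_n -> 'rV[R]_n -> 'rV[R]_n)
    (X Y : 'rV[R]_n -> 'rV[R]_n) (x : 'rV[R]_n) : 'rV[R]_n :=
  lie_bracket (app A X) (app A Y) x
  - A x (lie_bracket (app A X) Y x)
  - A x (lie_bracket X (app A Y) x)
  + A x (A x (lie_bracket X Y x)).

(* The covariant derivative along [F] of the field [F_* Y] in the direction
   [F_* (X x)], for the connection with Christoffel symbols [G]. *)
Definition cov_along n m (F : 'rV[R]_n -> 'rV[R]_m)
    (G : 'rV[R]_m -> 'rV[R]_m -> 'rV[R]_m -> 'rV[R]_m)
    (X Y : 'rV[R]_n -> 'rV[R]_n) (x : 'rV[R]_n) : 'rV[R]_m :=
  'D_(X x) (fun y => 'D_(Y y) F y) x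
  + G (F x) ('D_(X x) F x) ('D_(Y x) F x).

Definition cov n (G : 'rV[R]_n -> 'rV[R]_n -> 'rV[R]_n -> 'rV[R]_n)
    (X Y : 'rV[R]_n -> 'rV[R]_n) (x : 'rV[R]_n) : 'rV[R]_n :=
  'D_(X x) Y x + G x (X x) (Y x).

End LocalFields.

Arguments wedge_pow {R n} t d.

(* Fields on a manifold are families of local fields on the chart ranges which
   obey the transformation law under changes of charts. *)
Section FieldsOnManifolds.
Context {R : realType} {n : nat} (M : manifold R n).
Implicit Types (i j : chart M) (x : 'rV[R]_n).

Definition crange i : set 'rV[R]_n := cmap i @` cdom i.
Definition ctrans i j : 'rV[R]_n -> 'rV[R]_n := cmap j \o cinv i.
Definition coverlap i j : set 'rV[R]_n := crange i `&` (cinv i @^-1` cdom j).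

Definition tensor_data (k : nat) := chart M -> @ctensor R n k.
Definition vector_data := chart M -> 'rV[R]_n -> 'rV[R]_n.
Definition endo_data := chart M -> 'rV[R]_n -> 'rV[R]_n -> 'rV[R]_n.
Definition connection_data :=
  chart M -> 'rV[R]_n -> 'rV[R]_n -> 'rV[R]_n -> 'rV[R]_n.

Record is_tensor k (T : tensor_data k) : Prop := IsTensor {
  tensor_multilinear : forall i x, crange i x -> multilinear (T i x);
  tensor_smooth : forall i v, smooth_on (crange i) (fun x => T i x v);
  tensor_trans : forall i j x v, coverlap i j x ->
    T i x v = pullback (ctrans i j) (T j) x v }.

Record is_form k (w : tensor_data k) : Prop := IsForm {
  form_tensor : is_tensor w;
  form_alternating : forall i x, crange i x -> alternating (w i x) }.

Record is_vector_field (E : vector_data) : Prop := IsVectorField {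
  vector_smooth : forall i, smooth_on (crange i) (E i);
  vector_trans : forall i j x, coverlap i j x ->
    E j (ctrans i j x) = 'D_(E i x) (ctrans i j) x }.

Record is_endo_field (A : endo_data) : Prop := IsEndoField {
  endo_linear : forall i x, crange i x -> linear (A i x);
  endo_smooth : forall i v, smooth_on (crange i) (fun x => A i x v);
  endo_trans : forall i j x v, coverlap i j x ->
    A j (ctrans i j x) ('D_v (ctrans i j) x) = 'D_(A i x v) (ctrans i j) x }.

(* A linear connection, given by its Christoffel symbols:
   nabla_X Y = D_X Y + G(X, Y) in each chart.  The transformation law says that
   the change of charts maps nabla_u v, for constant fields u and v, to the
   covariant derivative of the image fields. *)
Record is_connection (G : connection_data) : Prop := IsConnection {
  connection_linearl : forall i x v, crange i x -> linear (G i x ^~ v);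
  connection_linearr : forall i x u, crange i x -> linear (G i x u);
  connection_smooth : forall i u v,
    smooth_on (crange i) (fun x => G i x u v);
  connection_trans : forall i j x u v, coverlap i j x ->
    'D_(G i x u v) (ctrans i j) x
    = cov_along (ctrans i j) (G j) (fun=> u) (fun=> v) x }.

Definition closed_form k (w : tensor_data k) : Prop :=
  forall i x v, crange i x -> ext_deriv (w i) x v = 0.

Definition totally_symmetric k (T : tensor_data k) : Prop :=
  forall i x, crange i x -> symmetric_form (T i x).

Record is_riemannian (g : tensor_data 2) : Prop := IsRiemannian {
  riemannian_tensor : is_tensor g;
  riemannian_symmetric : totally_symmetric g;
  riemannian_pos : forall i x v, crange i x -> v != 0 ->
    0 < ev2 (g i) x v v }.

Definition torsion_free (G : connection_data) : Prop :=
  forall i X Y x, smooth_on (crange i) X -> smooth_on (crange i) Y ->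
    crange i x -> cov (G i) X Y x - cov (G i) Y X x = lie_bracket X Y x.

Definition dual_connections (g : tensor_data 2) (G Gs : connection_data) :
    Prop :=
  forall i X Y Z x, smooth_on (crange i) X -> smooth_on (crange i) Y ->
    smooth_on (crange i) Z -> crange i x ->
    'D_(X x) (fun y => ev2 (g i) y (Y y) (Z y)) x
    = ev2 (g i) x (cov (G i) X Y x) (Z x)
      + ev2 (g i) x (Y x) (cov (Gs i) X Z x).

Definition parallel_tensor2 (G : connection_data) (w : tensor_data 2) : Prop :=
  forall i X Y Z x, smooth_on (crange i) X -> smooth_on (crange i) Y ->
    smooth_on (crange i) Z -> crange i x ->
    'D_(X x) (fun y => ev2 (w i) y (Y y) (Z y)) x
    = ev2 (w i) x (cov (G i) X Y x) (Z x)
      + ev2 (w i) x (Y x) (cov (G i) X Z x).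

Definition parallel_vector (G : connection_data) (E : vector_data) : Prop :=
  forall i X x, smooth_on (crange i) X -> crange i x ->
    cov (G i) X (E i) x = 0.

Record is_levi_civita (g : tensor_data 2) (G : connection_data) : Prop :=
  IsLeviCivita {
    levi_civita_connection : is_connection G;
    levi_civita_torsion_free : torsion_free G;
    levi_civita_metric : parallel_tensor2 G g }.

Definition difference_tensor (g : tensor_data 2) (G Gs : connection_data)
    (T : tensor_data 3) : Prop :=
  forall i X Y Z x, smooth_on (crange i) X -> smooth_on (crange i) Y ->
    smooth_on (crange i) Z -> crange i x ->
    ev3 (T i) x (X x) (Y x) (Z x)
    = ev2 (g i) x (cov (Gs i) X Y x - cov (G i) X Y x) (Z x).

Definition nijenhuis_free (A : endo_data) : Prop :=
  forall i X Y x, smooth_on (crange i) X -> smooth_on (crange i) Y ->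
    crange i x -> nijenhuis (A i) X Y x = 0.

Record is_kahler (W : tensor_data 2) (J : endo_data) (g : tensor_data 2) :
    Prop := IsKahler {
  kahler_dim : exists d, n = (d * 2)%N;
  kahler_form : is_form W;
  kahler_closed : closed_form W;
  kahler_endo : is_endo_field J;
  kahler_riemannian : is_riemannian g;
  kahler_square : forall i x v, crange i x -> J i x (J i x v) = - v;
  kahler_integrable : nijenhuis_free J;
  kahler_compat : forall i x u v, crange i x ->
    ev2 (g i) x u v = ev2 (W i) x u (J i x v) }.

Record is_cokahler (d : nat) (W : tensor_data 2) (a : tensor_data 1)
    (A : endo_data) (E : vector_data) (g : tensor_data 2) : Prop :=
  IsCokahler {
  cokahler_dim : n = (1 + d * 2)%N;
  cokahler_form2 : is_form W;
  cokahler_closed2 : closed_form W;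
  cokahler_form1 : is_form a;
  cokahler_closed1 : closed_form a;
  cokahler_volume : forall i x, crange i x ->
    exists v, wedge (a i x) (wedge_pow (W i x) d) v != 0;
  cokahler_endo : is_endo_field A;
  cokahler_vector : is_vector_field E;
  cokahler_riemannian : is_riemannian g;
  cokahler_reeb2 : forall i x v, crange i x -> ev2 (W i) x (E i x) v = 0;
  cokahler_reeb1 : forall i x, crange i x -> ev1 (a i) x (E i x) = 1;
  cokahler_square : forall i x v, crange i x ->
    A i x (A i x v) = - v + ev1 (a i) x v *: E i x;
  cokahler_endo_reeb : forall i x, crange i x -> A i x (E i x) = 0;
  cokahler_form1_endo : forall i x v, crange i x ->
    ev1 (a i) x (A i x v) = 0;
  cokahler_metric_reeb : forall i x v, crange i x ->
    ev1 (a i) x v = ev2 (g i) x v (E i x);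
  cokahler_compat : forall i x u v, crange i x ->
    ev2 (g i) x u v
    = ev2 (W i) x u (A i x v) + ev1 (a i) x u * ev1 (a i) x v;
  cokahler_normal : nijenhuis_free A }.

Definition kahler_statistical (g : tensor_data 2) (T : tensor_data 3) : Prop :=
  exists (W : tensor_data 2) (J : endo_data) (G Gs : connection_data),
    is_kahler W J g /\
    [/\ is_connection G, is_connection Gs, torsion_free G & torsion_free Gs] /\
    [/\ dual_connections g G Gs, parallel_tensor2 G W &
        difference_tensor g G Gs T].

Definition cokahler_statistical (g : tensor_data 2) (T : tensor_data 3) :
    Prop :=
  exists (d : nat) (W : tensor_data 2) (a : tensor_data 1) (A : endo_data)
    (E : vector_data) (G Gs : connection_data),
    is_cokahler d W a A E g /\
    [/\ is_connection G, is_connection Gs, torsion_free G & torsion_free Gs] /\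
    [/\ dual_connections g G Gs, parallel_tensor2 G W, parallel_vector G E &
        difference_tensor g G Gs T].

End FieldsOnManifolds.

Section Maps.
Context {R : realType} {n m : nat} {M : manifold R n} {N : manifold R m}.
Variable f : M -> N.

Definition loc (i : chart M) (j : chart N) : 'rV[R]_n -> 'rV[R]_m :=
  cmap j \o f \o cinv i.

Definition loc_dom (i : chart M) (j : chart N) : set 'rV[R]_n :=
  crange i `&` ((f \o cinv i) @^-1` cdom j).

Record smooth_embedding : Prop := SmoothEmbedding {
  embedding_continuous : continuous f;
  embedding_smooth : forall i j, smooth_on (loc_dom i j) (loc i j);
  embedding_immersion : forall i j x v, loc_dom i j x ->
    'D_v (loc i j) x = 0 -> v = 0;
  embedding_inj : injective f;
  embedding_open : forall U : set M, open U ->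
    exists2 V : set N, open V & f @` U = V `&` range f }.

Definition is_pullback k (T : tensor_data M k) (S : tensor_data N k) : Prop :=
  forall i j x v, loc_dom i j x -> T i x v = pullback (loc i j) (S j) x v.

Record isostatistical (g : tensor_data M 2) (T : tensor_data M 3)
    (h : tensor_data N 2) (K : tensor_data N 3) : Prop := Isostatistical {
  isostatistical_embedding : smooth_embedding;
  isostatistical_metric : is_pullback g h;
  isostatistical_tensor : is_pullback T K }.

(* nabla_X Y is tangent to [M] whenever X and Y are. *)
Definition totally_geodesic (G : connection_data N) : Prop :=
  forall i j X Y x, smooth_on (crange i) X -> smooth_on (crange i) Y ->
    loc_dom i j x ->
    exists u, cov_along (loc i j) (G j) X Y x = 'D_u (loc i j) x.

End Maps.

Section Simplex.
Context {R : realType} (N : nat).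

Definition simplex : set 'rV[R]_N.+1 :=
  [set p | (forall a, 0 < p 0 a) /\ \sum_a p 0 a = 1].

(* The chart (p_1, ..., p_{N+1}) |-> (p_1, ..., p_N) of the simplex. *)
Definition simplex_chart (p : set_type simplex) : 'rV[R]_N :=
  \row_b (val p : 'rV[R]_N.+1) 0 (widen_ord (leqnSn N) b).

Lemma widen_lift (b : 'I_N) : widen_ord (leqnSn N) b = lift ord_max b.
Proof. by apply: val_inj; rewrite /= /bump leqNgt ltn_ord. Qed.

Definition simplex_ext (x : 'rV[R]_N) : 'rV[R]_N.+1 :=
  \row_a (if unlift ord_max a is Some b then x 0 b else 1 - \sum_b x 0 b).

Definition uniform_prob : 'rV[R]_N.+1 := const_mx (N.+1%:R^-1).

Lemma uniform_prob_simplex : uniform_prob \in simplex.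
Proof.
rewrite inE; split => [a|]; first by rewrite mxE invr_gt0 ltr0n.
under eq_bigr do rewrite mxE.
by rewrite sumr_const card_ord -[LHS]mulr_natl mulfV ?pnatr_eq0.
Qed.

(* Outside the range of the chart the value is irrelevant. *)
Definition simplex_param (x : 'rV[R]_N) : set_type simplex :=
  insubd (exist _ uniform_prob uniform_prob_simplex : set_type simplex)
         (simplex_ext x).

Lemma simplex_ext_sum x : \sum_a simplex_ext x 0 a = 1.
Proof.
rewrite big_ord_recr /= mxE unlift_none /=.
have -> : \sum_(b < N) simplex_ext x 0 (widen_ord (leqnSn N) b) = \sum_b x 0 b.
  apply: eq_bigr => b _; rewrite mxE widen_lift liftK//.
by rewrite [LHS]addrC subrK.
Qed.

Lemma simplex_chartK : cancel simplex_chart simplex_param.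
Proof.
move=> p; apply: val_inj; rewrite /simplex_param val_insubd.
have pS := set_valP p.
suff -> : simplex_ext (simplex_chart p) = val p by case: ifPn => // /negP[]; exact: valP.
apply/rowP => a; rewrite mxE; case: unliftP => [b|] ->.
  by rewrite mxE widen_lift.
case: pS => _; rewrite big_ord_recr /= => <-.
rewrite (eq_bigr (fun b => simplex_chart p 0 b)); last by move=> b _; rewrite mxE.
by rewrite [X in X - _]addrC addrK.
Qed.

Lemma simplex_paramK x : simplex (simplex_ext x) ->
  simplex_chart (simplex_param x) = x.
Proof.
move=> xS; apply/rowP => b; rewrite mxE /simplex_param val_insubd mem_set//.
by rewrite mxE widen_lift liftK.
Qed.

Lemma simplex_chart_range :
  simplex_chart @` setT = [set x | forall a, 0 < simplex_ext x 0 a].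
Proof.
apply/seteqP; split => [_ [p _ <-] a|x xS].
  have := congr1 val (simplex_chartK p); rewrite /simplex_param val_insubd.
  case: ifPn => [/set_mem[+ _]|]; first by move=> + _; apply.
  move=> _ pu; have := set_valP p; rewrite /simplex.
  case=> p0 p1; rewrite mxE; case: unliftP => [b|] _; first by rewrite mxE.
  rewrite -p1 big_ord_recr /= (eq_bigr (fun b => simplex_chart p 0 b)); last first.
    by move=> b _; rewrite mxE.
  by rewrite [X in X - _]addrC addrK.
exists (simplex_param x) => //; apply: simplex_paramK; split => //.
exact: simplex_ext_sum.
Qed.

Lemma simplex_ext_coord_continuous a :
continuous (fun x : 'rV[R]_N => simplex_ext x 0 a).
Proof.
rewrite (_ : (fun y => _) = fun y : 'rV[R]_N =>
    if unlift ord_max a is Some b then y 0 b else 1 - \sum_(b < N) y 0 b); last by apply/funext => y; rewrite mxE.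
case: unlift => [b|] y; first exact: coord_continuous.
apply: continuousB; first exact: cst_continuous.
have sum_cont : continuous (fun y : 'rV[R]_N => \sum_(b < N) y 0 b).
  apply: (@continuous_big R 'I_N +%R 0 xpredT) => [|b _].
    exact: add_continuous.
  exact: coord_continuous.
exact: sum_cont.
Qed.

Lemma simplex_ext_continuous : continuous simplex_ext.
Proof.
move=> x A [P Pn PA].
have h a : nbhs x [set y | P 0 a (simplex_ext y 0 a)].
  exact: simplex_ext_coord_continuous (Pn 0 a).
have := @filter_forall _ _ _ _ (nbhs_filter x) h.
apply: (@filterS _ _ (nbhs_filter x)) => y yP; apply: PA => i a; rewrite ord1.
exact: yP.
Qed.

Lemma simplex_chart_range_open : open (simplex_chart @` setT).
Proof.
rewrite simplex_chart_range.
rewrite openE => x xP.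
have h a : nbhs x [set y | 0 < simplex_ext y 0 a].
  apply: (@simplex_ext_coord_continuous a x [set r | 0 < r]).
  by apply: open_nbhs_nbhs; split; [exact: open_gt|exact: xP].
have := @filter_forall _ _ _ _ (nbhs_filter x) h.
by apply: (@filterS _ _ (nbhs_filter x)) => y yP a; exact: yP.
Qed.

Lemma simplex_chart_continuous : continuous simplex_chart.
Proof.
have cont a : continuous (fun p : set_type simplex => (val p : 'rV[R]_N.+1) 0 a).
  move=> p; apply: (@continuous_comp (set_type simplex) 'rV[R]_N.+1 R set_val
    (fun q => q 0 a)); first exact: initial_continuous.
  exact: coord_continuous.
move=> p A [P Pn PA].
have h b : nbhs p [set q : set_type simplex |
    P 0 b ((val q : 'rV[R]_N.+1) 0 (widen_ord (leqnSn N) b))].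
  by apply: cont; have := Pn 0 b; rewrite mxE.
have := @filter_forall _ _ _ _ (nbhs_filter p) h.
apply: (@filterS _ _ (nbhs_filter p)) => q qP; apply: PA => i b; rewrite ord1 mxE.
exact: qP.
Qed.

Lemma simplex_param_continuous x : (simplex_chart @` setT) x ->
  {for x, continuous simplex_param}.
Proof.
move=> xr; have xn : \near x, (simplex_chart @` setT) x.
  exact: (open_nbhs_nbhs (conj simplex_chart_range_open xr)).
move=> A [_ [[B oB <-] /= Bx sBA]].
have {}xE y : (simplex_chart @` setT) y ->
    set_val (simplex_param y) = simplex_ext y.
  rewrite simplex_chart_range => yr; rewrite /simplex_param.
  by rewrite set_valE val_insubd mem_set//; split => //; exact: simplex_ext_sum.
rewrite xE// in Bx.
have hB : nbhs x (simplex_ext @^-1` B).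
  by apply: simplex_ext_continuous; exact: open_nbhs_nbhs.
have := @filterI _ _ (nbhs_filter x) _ _ xn hB.
by apply: (@filterS _ _ (nbhs_filter x)) => y [yr yB]; apply: sBA; rewrite /= xE.
Qed.

Lemma simplex_hausdorff : hausdorff_space (set_type simplex).
Proof.
move=> p q pq; apply: val_inj; apply: (@norm_hausdorff R 'rV[R]_N.+1) => A B pA qB.
have ic := @initial_continuous _ _ (set_val : set_type simplex -> _).
have [r [? ?]] := pq _ _ (ic p _ pA) (ic q _ qB).
by exists (set_val r).
Qed.

Lemma simplex_second_countable : @second_countable (set_type simplex).
Proof.
pose b (qk : 'rV[rat]_N.+1 * nat) : set (set_type simplex) :=
  set_val @^-1` (ball (map_mx ratr qk.1 : 'rV[R]_N.+1) qk.2.+1%:R^-1)°.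
exists (range b); first by apply: card_le_trans (card_image_le _ _) (countableP _).
split=> [_ [qk _ <-]|p A [_ [[B oB <-] /= Bp sBA]]].
  by exists (ball (map_mx ratr qk.1 : 'rV[R]_N.+1) qk.2.+1%:R^-1)° => //; exact: open_interior.
have /nbhs_ballP[e /= e0 eB] : nbhs (set_val p : 'rV[R]_N.+1) B by exact: open_nbhs_nbhs.
have [k ke] : exists k : nat, k.+1%:R^-1 < e / 2.
  have [k] := ltr_add_invr (divr_gt0 e0 (ltr0n R 2)); rewrite add0r; by exists k.
have k0 : 0 < k.+1%:R^-1 / 2 :> R by rewrite divr_gt0.
have /fin_all_exists[q qP] (a : 'I_N.+1) : exists q : rat,
    `|(set_val p : 'rV[R]_N.+1) 0 a - ratr q| < k.+1%:R^-1 / 2.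
  have [//|q] := @rat_in_itvoo R ((set_val p : 'rV[R]_N.+1) 0 a - k.+1%:R^-1 / 2) ((set_val p : 'rV[R]_N.+1) 0 a + k.+1%:R^-1 / 2).
    by rewrite ltrD2l gtrN.
  rewrite in_itv /= => /andP[h1 h2]; exists q; rewrite distrC ltr_distl.
  by rewrite h1 h2.
exists (b (\row_a q a, k)) => /=; first split.
- by exists (\row_a q a, k).
- rewrite /b /= /interior; apply/nbhs_ballP; exists (k.+1%:R^-1 / 2) => //= y [_ py].
  split => //.
  move=> i a; rewrite !mxE [X in ball _ X](splitr); apply: ball_triangle (py _ _).
  by rewrite ord1; apply: ball_sym; exact: qP.
- move=> y /interior_subset/= qy; apply: sBA; apply: eB => /=.
  rewrite [X in ball _ X](splitr); apply: (@ball_triangle _ _ (map_mx ratr (\row_a q a) : 'rV[R]_N.+1)).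
    split; first by rewrite divr_gt0.
    move=> i a; rewrite !mxE ord1 /ball /=; apply: lt_trans (qP a) _.
    apply: le_lt_trans ke; rewrite ler_pdivrMr// ler_peMr// ?ler1n//.
  exact: (le_ball (ltW ke)).
Qed.

Lemma smooth_on_eq_id (U : set 'rV[R]_N) (f : 'rV[R]_N -> 'rV[R]_N) :
  open U -> (forall x, U x -> f x = x) -> smooth_on U f.
Proof.
move=> oU fE.
have nf x : U x -> {near x, id =1 f}.
  move=> Ux; have : \near x, U x by exact: open_nbhs_nbhs.
  by apply: filterS => y /fE.
have cf x : U x -> {for x, continuous f}.
  move=> Ux; rewrite /prop_for /continuous_at fE//.
  exact: cvg_trans (near_eq_cvg (nf _ Ux)) cvg_id.
have cst_Ck : forall k (g : 'rV[R]_N -> 'rV[R]_N) c,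
    (forall x, U x -> g x = c) -> Ck k U g.
  elim=> [|k IH] g c gE.
    split=> // x Ux; have ng : {near x, cst c =1 g}.
      have : \near x, U x by exact: open_nbhs_nbhs.
      by apply: filterS => y /gE.
    rewrite /prop_for /continuous_at gE//.
    exact: cvg_trans (near_eq_cvg ng) (cvg_cst _).
  have ng x : U x -> {near x, cst c =1 g}.
    move=> Ux; have : \near x, U x by exact: open_nbhs_nbhs.
    by apply: filterS => y /gE.
  split=> [x Ux|j].
    rewrite /prop_for /continuous_at gE//.
    exact: cvg_trans (near_eq_cvg (ng _ Ux)) (cvg_cst _).
  split=> [x Ux|]; first exact: near_eq_derivable (ng _ Ux) (derivable_cst _ _ _).
  by apply: (IH _ 0) => x Ux; rewrite -(near_eq_derive _ (ng _ Ux)) derive_cst.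
case=> [|k]; split => // j; split=> [x Ux|].
  apply: near_eq_derivable (nf _ Ux) _; exact: derivable_id.
apply: (cst_Ck k _ (delta_mx 0 j)) => x Ux.
by rewrite -(near_eq_derive _ (nf _ Ux)) derive_id.
Qed.

Lemma simplex_trans_smooth : smooth_on
  ((simplex_chart @` setT) `&` (simplex_param @^-1` setT))
  (simplex_chart \o simplex_param).
Proof.
rewrite preimage_setT setIT; apply: smooth_on_eq_id => [|x [p _ <-] /=].
  exact: simplex_chart_range_open.
by rewrite simplex_chartK.
Qed.

Definition prob_manifold : manifold R N := @Manifold R N (set_type simplex)
  unit (fun=> setT) (fun=> simplex_chart) (fun=> simplex_param)
  simplex_hausdorff simplex_second_countable
  (fun=> openT) (fun p => ex_intro _ tt I)
  (fun=> simplex_chart_range_open) (fun _ p _ => simplex_chartK p)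
  (fun _ p _ => @simplex_chart_continuous p)
  (fun _ x xr => @simplex_param_continuous x xr)
  (fun _ _ => simplex_trans_smooth).

Definition prob (i : chart prob_manifold) (x : 'rV[R]_N) (a : 'I_N.+1) : R :=
  (val (cinv i x : set_type simplex) : 'rV[R]_N.+1) 0 a.

(* E_p(d log p (v_0) ... d log p (v_{k-1})). *)
Definition score_moment (k : nat) : tensor_data prob_manifold k :=
  fun i x v => \sum_(a < N.+1) prob i x a *
    \prod_(l < k) 'D_(v l) (fun y => ln (prob i y a)) x.

Definition fisher : tensor_data prob_manifold 2 := @score_moment 2.

Definition amari_chentsov : tensor_data prob_manifold 3 := @score_moment 3.

End Simplex.

Arguments prob_manifold R N : clear implicits.
Arguments fisher R N : clear implicits.
Arguments amari_chentsov R N : clear implicits.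

(* Main.v *)
From HB Require Import structures.
Require Import Defs.
From mathcomp Require Import all_boot all_order all_algebra.
From mathcomp Require Import all_classical all_reals all_analysis.
From mathcomp Require Import ring lra.

Set Implicit Arguments.
Unset Strict Implicit.
Unset Printing Implicit Defensive.

Import Order.TTheory GRing.Theory Num.Theory.
Import numFieldNormedType.Exports.

Local Open Scope classical_set_scope.
Local Open Scope ring_scope.

(** The square roots of the probabilities map the simplex with its Fisher metric
    onto an open piece of the sphere of radius 2, the positive orthant, and each
    square root satisfies Hess (sqrt p_c) = - sqrt p_c g / 4, like every linear
    function on that sphere.  A totally geodesic submanifold inherits the
    equation, because its second fundamental form vanishes.  Now a positive
    function whose Hessian is negative definite has no minimum, whereas every
    continuous function on a nonempty compact space has one.  So the
    obstruction is that a complete totally geodesic submanifold of the sphere is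
    a great subsphere, which leaves the positive orthant.

    The proof uses p_c instead of its square root, because p_c is affine in the
    chart of the simplex.  At a critical point of p_c on the submanifold the
    equation becomes Hess p_c (v, v) = - p_c g(v, v) / 2 for v tangent to the
    submanifold.  For constant v, the left-hand side is minus the c-th component
    of nabla_v v, which [levi_civita_fisher_prob] computes.
    [totally_geodesic_no_min] compares the sign with the second derivative test
    [derive2_at_min] along a coordinate line of the submanifold. *)

(** * Directional derivatives and minima *)

Lemma near0_ball (R : realType) (P : set R) : (\forall h \near (0 : R), P h) ->
  exists2 e : R, 0 < e & forall h : R, `|h| < e -> P h.
Proof.
move=> /nbhs_ballP[e /= e0 eP]; exists e => // h he; apply: eP.
by rewrite /ball /= sub0r normrN.
Qed.

Lemma crange_nbhs (R : realType) n (M : manifold R n) (i : chart M) (x : 'rV[R]_n) :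
  crange i x -> \forall y \near x, crange i y.
Proof. by move=> xr; apply: open_nbhs_nbhs; split=> //; exact: crange_open. Qed.

Lemma smooth_on_cst (R : realType) n (V : normedModType R) (U : set 'rV[R]_n) (c : V) :
  smooth_on U (fun=> c).
Proof.
move=> k; elim: k c => [|k IH] c.
  by split=> // x _; exact: cst_continuous.
split=> [x _|j]; first exact: cst_continuous.
split=> [x _|]; first exact: derivable_cst.
rewrite [X in Ck k U X](_ : _ = fun=> 0); first exact: IH.
by apply/funext => x; rewrite derive_cst.
Qed.

Section DirectionalDerivatives.
Context {R : realType} {V : normedModType R}.

(** Reduces a directional derivative to the derivative of a function of one real
    variable, for which the chain rule and the mean value theorem hold. *)
Lemma is_derive_lineP (W : normedModType R) (f : V -> W) x v (t : R) d :
  is_derive (t *: v + x) v f d <->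
  is_derive t 1 (fun h : R => f (h *: v + x)) d.
Proof.
have E : (fun h : R => h^-1 *: ((f \o shift (t *: v + x)) (h *: v) -
                               f (t *: v + x))) =
  (fun h : R => h^-1 *: (((fun s : R => f (s *: v + x)) \o shift t) (h *: 1) -
                        f (t *: v + x))).
  by apply/funext => h /=; rewrite addrA -scalerDl [h *: 1]mulr1.
split=> -[df dE]; apply: DeriveDef.
- by rewrite /derivable -E.
- by rewrite -dE /derive -E.
- by rewrite /derivable E.
- by rewrite -dE /derive E.
Qed.

Lemma near_line x v (P : set V) :
  (\forall y \near x, P y) -> \forall h \near (0 : R), P (h *: v + x).
Proof.
have : (h *: v + x) @[h --> (0 : R)] --> 0 *: v + x.
  by apply: cvgD; [apply: cvgZr_tmp; exact: cvg_id | exact: cvg_cst].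
by rewrite scale0r add0r => + Px => /(_ _ Px).
Qed.

Lemma derive_near_quotient (f : V -> R) x v d : is_derive x v f d -> d != 0 ->
  \forall h \near (0 : R), h != 0 ->
    `|d - h^-1 * (f (h *: v + x) - f x)| < `|d|.
Proof.
move=> [/cvg_ex[/= l fl] fE] d0; have ll : l = d by rewrite -fE; apply/esym/cvg_lim.
by move/cvgrPdist_lt: fl => /(_ `|d|); rewrite ll normr_gt0 => /(_ d0).
Qed.

(** Fermat's rule, with derivability at the point [x] only: this is used along
    directions in which nothing is known about the neighbouring points.  If [d]
    were nonzero, the difference quotients would have its sign near [x], and a
    step against that sign would decrease [f]. *)
Lemma derive_at_min (f : V -> R) x v d :
  is_derive x v f d -> (\forall y \near x, f x <= f y) -> d = 0.
Proof.
move=> fd fmin; apply/eqP; apply/negPn/negP => d0.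
have [e e0 eP] :=
  near0_ball (filterI (derive_near_quotient fd d0) (near_line v fmin)).
have {}eP h : h != 0 -> `|h| < e -> 0 <= h * (h^-1 * (f (h *: v + x) - f x)) /\
    `|d - h^-1 * (f (h *: v + x) - f x)| < `|d|.
  move=> h0 he; have [/(_ h0) hq fh] := eP h he.
  by rewrite mulVKf // subr_ge0.
have e20 : 0 < e / 2 by rewrite divr_gt0.
have e2e : e / 2 < e by rewrite ltr_pdivrMr// ltr_pMr// ltr1n.
(* The step is taken downhill: forwards if [d < 0], backwards if [d > 0]. *)
have [d_lt0|d_gt0|/eqP] := ltgtP d 0; last by rewrite (negbTE d0).
- have := eP (e / 2); rewrite gt_eqF// gtr0_norm// => /(_ isT e2e)[].
  by rewrite pmulr_rge0// (ltr0_norm d_lt0) ltr_norml => q0 /andP[]; lra.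
- have := eP (- (e / 2)); rewrite oppr_eq0 gt_eqF// normrN gtr0_norm//.
  move=> /(_ isT e2e)[]; rewrite mulNr oppr_ge0 pmulr_rle0// (gtr0_norm d_gt0).
  by rewrite ltr_norml => q0 /andP[]; lra.
Qed.

(** If [d < 0], the derivative [f'], which vanishes at [x], is negative just after
    [x] on the line along [v]; by the mean value theorem [f] then drops below its
    minimum. *)
Lemma derive2_at_min (f f' : V -> R) x v d :
  (\forall y \near x, is_derive y v f (f' y)) -> is_derive x v f' d ->
  (\forall y \near x, f x <= f y) -> 0 <= d.
Proof.
move=> ff' f'd fmin; rewrite leNgt; apply/negP => d0.
have f'x : f' x = 0 by apply: derive_at_min (nbhs_singleton ff') fmin.
have dn0 : d != 0 by rewrite lt_eqF.
have [e e0 eP] := near0_ball (filterI (derive_near_quotient f'd dn0)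
  (filterI (near_line v ff') (near_line v fmin))).
pose g (h : R) := f (h *: v + x).
have {}eP h : 0 <= h < e -> [/\ 0 < h -> f' (h *: v + x) < 0,
    is_derive h 1 g (f' (h *: v + x)) & g 0 <= g h].
  move=> /andP[h0 he]; have := eP h; rewrite ger0_norm// => /(_ he)[hq [fd fx]].
  split; [|exact/is_derive_lineP|by rewrite /g scale0r add0r].
  move=> hp; move: hq; rewrite gt_eqF// => /(_ isT).
  rewrite f'x subr0 (ltr0_norm d0) ltr_norml => /andP[+ _].
  have : 0 < h^-1 by rewrite invr_gt0. nra.
have e20 : 0 < e / 2 by rewrite divr_gt0.
have e2e : e / 2 < e by rewrite ltr_pdivrMr// ltr_pMr// ltr1n.
have ge h : h \in `[0, e / 2] -> 0 <= h < e.
  by rewrite in_itv /= => /andP[-> /le_lt_trans]; exact.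
have [| |c c_itv gE] := @MVT _ g (fun h => f' (h *: v + x)) _ _ e20.
- by move=> h /subset_itv_oo_cc/ge/eP[].
- by apply: derivable_within_continuous => h /ge/eP[_ []].
have e2in : e / 2 \in `[0, e / 2] by rewrite in_itv /= lexx ltW.
have [_ _] := eP _ (ge _ e2in).
have [f'c _ _] := eP _ (ge _ (subset_itv_oo_cc c_itv)).
rewrite -subr_ge0 gE subr0 pmulr_lge0// leNgt f'c//.
by move: c_itv; rewrite in_itv => /andP[].
Qed.

Lemma is_derive_ln (f : V -> R) x v d : 0 < f x ->
  is_derive x v f d -> is_derive x v (fun y => ln (f y)) (d / f x).
Proof.
move=> f0 fd.
have line y : 0 *: v + y = y by rewrite scale0r add0r.
have fl : is_derive (0 : R) 1 (fun h : R => f (h *: v + x)) d.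
  by apply/is_derive_lineP; rewrite line.
have f0' : 0 < f (0 *: v + x) by rewrite line.
have := @is_derive1_comp _ _ _ _ _ _ (is_derive1_ln f0') fl.
rewrite [_^-1 * d]mulrC => lnd.
by rewrite -(line x); apply/is_derive_lineP; rewrite -{2}(line x).
Qed.

End DirectionalDerivatives.

(** * The Fisher metric in the chart of the simplex *)

Section SimplexChart.
Context {R : realType} {N : nat}.
Implicit Types (u v w x : 'rV[R]_N) (a c : 'I_N.+1).

(** The linear part of the affine map [simplex_ext]: the variation of the [a]-th
    probability along the chart vector [v]. *)
Definition simplex_dir a v : R := simplex_ext v 0 a - simplex_ext 0 0 a.

Lemma simplex_dirE v a : simplex_dir a v =
  if unlift ord_max a is Some b then v 0 b else - \sum_b v 0 b.
Proof.
rewrite /simplex_dir !mxE; case: unlift => [b|]; first by rewrite mxE subr0.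
have -> : \sum_b (0 : 'rV[R]_N) 0 b = 0 by apply: big1 => b _; rewrite mxE.
by rewrite subr0 addrAC subrr add0r.
Qed.

Lemma simplex_dir_linear a : scalar (simplex_dir a).
Proof.
move=> h v w; rewrite !simplex_dirE; case: unlift => [b|]; first by rewrite !mxE.
rewrite mulrN -opprD mulr_sumr -big_split /=.
by congr (- _); apply: eq_bigr => b _; rewrite !mxE.
Qed.

HB.instance Definition _ a :=
  GRing.isLinear.Build R 'rV[R]_N R *%R (simplex_dir a) (simplex_dir_linear a).

(** Chart vectors correspond to the vectors with zero sum of R^(N+1), by this
    lemma and the next two. *)
Lemma sum_simplex_dir v : \sum_a simplex_dir a v = 0.
Proof. by rewrite sumrB !simplex_ext_sum subrr. Qed.

Lemma simplex_dir_inj v : (forall a, simplex_dir a v = 0) -> v = 0.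
Proof.
move=> v0; apply/rowP => b; rewrite mxE -(v0 (lift ord_max b)).
by rewrite simplex_dirE liftK.
Qed.

Lemma simplex_dir_surj (s : 'I_N.+1 -> R) : \sum_a s a = 0 ->
  exists w, forall a, simplex_dir a w = s a.
Proof.
move=> s0; exists (\row_b s (lift ord_max b)) => a; rewrite simplex_dirE.
case: unliftP => [b|] ->; first by rewrite mxE.
move: s0; rewrite big_ord_recr /= => /eqP; rewrite addrC addr_eq0 => /eqP ->.
by congr (- _); apply: eq_bigr => b _; rewrite mxE widen_lift.
Qed.

(** A continuous linear form commutes with the limit that defines the derivative
    of [F], which need exist in the direction [e] only. *)
Lemma is_derive_simplex_dir (V : normedModType R) (F : V -> 'rV[R]_N) y e dF a :
  is_derive y e F dF ->
  is_derive y e (fun z => simplex_dir a (F z)) (simplex_dir a dF).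
Proof.
move=> [/cvg_ex[/= l Fl] FE].
have ll : l = dF by rewrite -FE; apply/esym/cvg_lim.
have dc : continuous (simplex_dir a).
  move=> z; apply: continuousB; last exact: cst_continuous.
  exact: simplex_ext_coord_continuous.
have : (h^-1 *: (((fun z => simplex_dir a (F z)) \o shift y) (h *: e) -
           simplex_dir a (F y))) @[h --> 0^'] --> simplex_dir a dF.
  rewrite -ll [X in X @ _](_ : _ =
    simplex_dir a \o (fun h : R => h^-1 *: ((F \o shift y) (h *: e) - F y))).
    exact: continuous_cvg (dc l) Fl.
  by apply/funext => h; rewrite [RHS]/= scalarZ [in RHS]linearB.
move=> H; apply: DeriveDef; first by apply/cvg_ex; exists (simplex_dir a dF).
exact/cvg_lim.
Qed.

Lemma is_derive_simplex_ext (V : normedModType R) (F : V -> 'rV[R]_N) y e dF a :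
  is_derive y e F dF ->
  is_derive y e (fun z => simplex_ext (F z) 0 a) (simplex_dir a dF).
Proof.
move=> Fd; have -> : (fun z => simplex_ext (F z) 0 a) =
    (fun z => simplex_dir a (F z)) + cst (simplex_ext 0 0 a).
  by apply/funext => z; rewrite /simplex_dir fctE subrK.
rewrite -[simplex_dir a dF]addr0; apply: is_deriveD.
exact: is_derive_simplex_dir.
Qed.

Lemma probE i x a : crange (M := prob_manifold R N) i x ->
  prob i x a = simplex_ext x 0 a.
Proof.
rewrite /crange [_ @` _]simplex_chart_range => xr.
rewrite /prob [cinv i x]/(simplex_param x) val_insubd mem_set//.
by split=> //; exact: simplex_ext_sum.
Qed.

Lemma prob_gt0 i x a : 0 < prob i x a.
Proof. by have [+ _] := set_valP (cinv i x); apply. Qed.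

Lemma sum_prob i x : \sum_a prob i x a = 1.
Proof. by have [_] := set_valP (cinv i x). Qed.

Lemma is_derive_prob i x v a : crange (M := prob_manifold R N) i x ->
  is_derive x v (fun y => prob i y a) (simplex_dir a v).
Proof.
move=> xr; apply: near_eq_is_derive (is_derive_simplex_ext a (is_derive_id x v)).
by apply: filterS (crange_nbhs xr) => y yr; rewrite probE.
Qed.

Lemma fisherE i x u v : crange (M := prob_manifold R N) i x ->
  ev2 (fisher R N i) x u v =
  \sum_a simplex_dir a u * simplex_dir a v / prob i x a.
Proof.
move=> xr; rewrite /ev2 /fisher /score_moment; apply: eq_bigr => a _.
have lnE w : 'D_w (fun y => ln (prob i y a)) x = simplex_dir a w / prob i x a.
  have pd := is_derive_prob w a xr.
  have := is_derive_ln (prob_gt0 i x a) pd => lnd.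
  by rewrite derive_val.
rewrite !big_ord_recl big_ord0 !lnE /= mulr1.
have p0 : prob i x a != 0 by rewrite gt_eqF// prob_gt0.
rewrite /tnth/=.
by field.
Qed.

(** The value is symmetric in [u], [v] and [w]: this makes the Koszul formula
    collapse to a single term. *)
Lemma derive_fisher i x u v w : crange (M := prob_manifold R N) i x ->
  'D_w (fun y => ev2 (fisher R N i) y u v) x =
  - \sum_a simplex_dir a u * simplex_dir a v * simplex_dir a w / prob i x a ^+ 2.
Proof.
move=> xr.
pose G a y := (simplex_dir a u * simplex_dir a v) *: (prob i y a)^-1.
rewrite (@near_eq_derive _ _ _ _ (\sum_a G a)); last first.
  apply: filterS (crange_nbhs xr) => y yr; rewrite fisherE// fct_sumE.
  by [].
have Gd a : is_derive x w (G a)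
  (- (simplex_dir a u * simplex_dir a v * simplex_dir a w / prob i x a ^+ 2)).
  have p0 : prob i x a != 0 by rewrite gt_eqF// prob_gt0.
  have [pd pE] := is_derive_prob w a xr.
  apply: DeriveDef; first exact/derivableZ/derivableV.
  rewrite deriveZ; last exact: derivableV.
  by rewrite deriveV// pE -![_ *: _]/(_ * _); field.
have := is_derive_sum Gd => H.
by rewrite derive_val sumrN.
Qed.

(** The Koszul formula for the constant fields [v], [v] and [w]: metricity in the
    directions [v] and [w] gives two equations, in which torsion-freeness
    identifies the products that involve [nabla_v w] and [nabla_w v]. *)
Lemma levi_civita_fisher (nabla0 : connection_data (prob_manifold R N)) i x v w :
  is_levi_civita (fisher R N) nabla0 -> crange i x ->
  ev2 (fisher R N i) x (nabla0 i x v v) w =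
  - (\sum_a simplex_dir a v * simplex_dir a v * simplex_dir a w / prob i x a ^+ 2) / 2.
Proof.
have koszul (a b s : R) : - s = a + b -> - s = b + b -> a = - s / 2.
  by move=> ? ?; lra.
move=> [_ tf metric] xr.
have covE u z : cov (nabla0 i) (fun=> u) (fun=> z) x = nabla0 i x u z.
  by rewrite /cov derive_cst add0r.
have sym u z : nabla0 i x u z = nabla0 i x z u.
  have := tf i (fun=> u) (fun=> z) x; rewrite !covE /lie_bracket !derive_cst subrr.
  by move/(_ (smooth_on_cst _ _) (smooth_on_cst _ _) xr) /eqP; rewrite subr_eq0 => /eqP.
have met u y z : 'D_u (fun q => ev2 (fisher R N i) q y z) x =
    ev2 (fisher R N i) x (nabla0 i x u y) z + ev2 (fisher R N i) x y (nabla0 i x u z).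
  have := metric i (fun=> u) (fun=> y) (fun=> z) x; rewrite !covE.
  by apply; exact: smooth_on_cst || exact: xr.
have fsym y z : ev2 (fisher R N i) x y z = ev2 (fisher R N i) x z y.
  by rewrite !fisherE//; apply: eq_bigr => a _; rewrite [X in X / _]mulrC.
pose S := \sum_a simplex_dir a v * simplex_dir a v * simplex_dir a w / prob i x a ^+ 2.
have Svw : 'D_v (fun y => ev2 (fisher R N i) y v w) x = - S.
  rewrite derive_fisher//; apply/oppr_inj; rewrite !opprK.
  by apply: eq_bigr => a _; rewrite [X in X / _ = _]mulrAC.
have Swv : 'D_w (fun y => ev2 (fisher R N i) y v v) x = - S.
  exact: derive_fisher.
have along_v := etrans (esym Svw) (met v v w).
have along_w := etrans (esym Swv) (met w v v).
move: along_w; rewrite [ev2 _ _ (nabla0 i x w v) v]fsym (sym w v).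
exact: koszul along_v.
Qed.

(** The vectors [p a * ((a == c) - p c)] that are summed against below are the
    components of the Fisher gradient of the [c]-th probability. *)
Lemma sum_mul_delta_sub (s : 'I_N.+1 -> R) c k :
  \sum_a s a * ((a == c)%:R - k) = s c - k * \sum_a s a.
Proof.
under eq_bigr do rewrite mulrBr [_ * k]mulrC.
rewrite sumrB -mulr_sumr (bigD1 c) //= eqxx mulr1 big1 ?addr0 // => a.
by move=> /negbTE ->; rewrite mulr0.
Qed.

(** Up to sign this is the Hessian of the [c]-th probability [p_c], which has no
    second derivative in the chart.  It comes from pairing [nabla_v v] with the
    Fisher gradient of [p_c]. *)
Lemma levi_civita_fisher_prob (nabla0 : connection_data (prob_manifold R N))
    i x v c :
  is_levi_civita (fisher R N) nabla0 -> crange i x ->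
  simplex_dir c (nabla0 i x v v) =
  (prob i x c * ev2 (fisher R N i) x v v - simplex_dir c v ^+ 2 / prob i x c) / 2.
Proof.
move=> lc xr.
have p0 a : prob i x a != 0 by rewrite gt_eqF// prob_gt0.
have cancel (q r s : R) : q != 0 -> r * (q * s) / q ^+ 2 = r / q * s.
  by move=> q0; field.
(* [w] is the Fisher gradient of the [c]-th probability, as [gw] shows. *)
have [|w wE] := @simplex_dir_surj (fun a => prob i x a * ((a == c)%:R - prob i x c)).
  by rewrite sum_mul_delta_sub sum_prob mulr1 subrr.
have gw u : ev2 (fisher R N i) x u w = simplex_dir c u.
  have -> : simplex_dir c u =
      \sum_a simplex_dir a u * ((a == c)%:R - prob i x c).
    by rewrite sum_mul_delta_sub sum_simplex_dir mulr0 subr0.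
  rewrite fisherE//; apply: eq_bigr => a _; rewrite wE.
  by rewrite -mulrA [X in _ * X]mulrC mulKf.
rewrite -gw levi_civita_fisher//; congr (_ / 2).
rewrite fisherE// expr2 -[RHS]opprB.
rewrite -(sum_mul_delta_sub (fun a => simplex_dir a v * simplex_dir a v / prob i x a)).
apply/oppr_inj; rewrite !opprK; apply: eq_bigr => a _; rewrite wE.
exact: cancel.
Qed.

Lemma fisher_gt0 i x v : crange i x -> v != 0 -> 0 < ev2 (fisher R N i) x v v.
Proof.
move=> xr v0; rewrite fisherE// lt_neqAle eq_sym.
have t0 a : 0 <= simplex_dir a v * simplex_dir a v / prob i x a.
  by rewrite divr_ge0 ?(ltW (prob_gt0 _ _ _))// -expr2 sqr_ge0.
rewrite sumr_ge0 ?andbT//; apply: contra v0; rewrite psumr_eq0// => /allP v0.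
apply/eqP/simplex_dir_inj => a; have := v0 a; rewrite mem_index_enum => /(_ isT).
rewrite mulf_eq0 invr_eq0 (gt_eqF (prob_gt0 i x a)) mulf_eq0 orbb.
by rewrite orbF => /eqP.
Qed.

End SimplexChart.

(** * Probabilities on a totally geodesic submanifold *)

Section Embeddings.
Context {R : realType} {N n : nat} {M : manifold R n}.
Variable f : M -> prob_manifold R N.

Definition prob_coord (c : 'I_N.+1) (p : M) : R :=
  (val (f p : set_type (@simplex R N)) : 'rV[R]_N.+1) 0 c.

Lemma prob_coord_continuous (c : 'I_N.+1) : smooth_embedding f ->
  continuous (prob_coord c).
Proof.
move=> [fc _ _ _ _] p.
pose coord (q : prob_manifold R N) :=
  (val (q : set_type (@simplex R N)) : 'rV[R]_N.+1) 0 c.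
apply: (@continuous_comp M (prob_manifold R N) R f coord); first exact: fc.
apply: (@continuous_comp (set_type (@simplex R N)) 'rV[R]_N.+1 R set_val
  (fun q => q 0 c)); first exact: initial_continuous.
exact: coord_continuous.
Qed.

Let F (i : chart M) := loc f i (tt : chart (prob_manifold R N)).

Lemma simplex_ext_loc i y c : simplex_ext (F i y) 0 c = prob_coord c (cinv i y).
Proof.
rewrite -(@probE _ _ tt) /prob; last by exists (f (cinv i y)).
by rewrite [cinv _ _](simplex_chartK (f (cinv i y))).
Qed.

(** At a minimum of the [c]-th probability on the submanifold, every tangent
    vector has zero [c]-th component. *)
Lemma simplex_dir_derive_at_min i x w c :
  (forall q, prob_coord c (cinv i x) <= prob_coord c q) ->
  simplex_dir c ('D_w (F i) x) = 0.
Proof.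
move=> pmin; have [Fd|nFd] := pselect (derivable (F i) x w).
  apply: derive_at_min (is_derive_simplex_ext c (derivableP Fd)) _.
  by apply: (@filterE _ _ (nbhs_filter x)) => y; rewrite !simplex_ext_loc.
(* Without a limit of the difference quotients, ['D_w (F i) x] is the default
   value of the limit operator, the zero vector. *)
have -> : 'D_w (F i) x = 0 by rewrite /derive dvgP//; apply/rowP => b; rewrite !mxE.
exact: linear0.
Qed.

(** Let [v] be the velocity and [acc] the acceleration, in the chart of the
    simplex, of a coordinate line of the submanifold through the minimum.  Total
    geodesy makes [acc + nabla_v v] tangent, so its [c]-th component vanishes.
    That of [acc] is nonnegative because of the minimum, and that of [nabla_v v]
    is half the product of the probability and [g(v, v)], since that of [v] is zero
    at the minimum.  This is positive, which is a contradiction. *)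
Lemma totally_geodesic_no_min nabla0 p c : (0 < n)%N ->
  smooth_embedding f -> is_levi_civita (fisher R N) nabla0 ->
  totally_geodesic f nabla0 ->
  ~ (forall q, prob_coord c p <= prob_coord c q).
Proof.
move=> n0 [_ fsm fimm _ _] lc tg pmin.
have [i ip] := cdom_cover p; pose x := cmap i p.
have xr : crange i x by exists p.
have dom y : crange i y -> loc_dom f i (tt : chart (prob_manifold R N)) y by split.
have {}pmin q : prob_coord c (cinv i x) <= prob_coord c q by rewrite cmapK.
pose e : 'rV[R]_n := delta_mx 0 (Ordinal n0).
have e0 : e != 0.
  apply/eqP => /rowP/(_ (Ordinal n0)); rewrite !mxE !eqxx.
  by move/eqP; rewrite oner_eq0.
have [_ /(_ (Ordinal n0))[Fd [_ /(_ (Ordinal n0))[Fdd _]]]] :=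
  fsm i (tt : chart (prob_manifold R N)) 2.
pose v := 'D_e (F i) x.
have v0 : v != 0 by apply: contra_neq e0; exact: (fimm _ _ _ _ (dom _ xr)).
have Fxr : crange (M := prob_manifold R N) tt (F i x).
  by exists (f (cinv i x)).
pose acc := 'D_e (fun y => 'D_e (F i) y) x.
have acc_ge0 : 0 <= simplex_dir c acc.
  apply: (@derive2_at_min _ _ (fun y => simplex_ext (F i y) 0 c)
    (fun y => simplex_dir c ('D_e (F i) y)) x e).
  - apply: filterS (crange_nbhs xr) => y /dom/Fd Fy.
    exact/is_derive_simplex_ext/derivableP.
  - exact/is_derive_simplex_dir/derivableP/Fdd/dom.
  - by apply: (@filterE _ _ (nbhs_filter x)) => y; rewrite !simplex_ext_loc.
have tangent : simplex_dir c acc + simplex_dir c (nabla0 tt (F i x) v v) = 0.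
  have cst_smooth : smooth_on (crange i) (fun=> e) by exact: smooth_on_cst.
  have [u geo] := tg i tt _ _ x cst_smooth cst_smooth (dom _ xr).
  have acc_tangent : acc + nabla0 tt (F i x) v v = 'D_u (F i) x by exact: geo.
  by rewrite -linearD acc_tangent; exact: simplex_dir_derive_at_min.
have v_crit : simplex_dir c v = 0 by exact: simplex_dir_derive_at_min.
have := levi_civita_fisher_prob v c lc Fxr; rewrite v_crit expr0n mul0r subr0.
have := mulr_gt0 (prob_gt0 tt (F i x) c) (fisher_gt0 Fxr v0).
move: tangent acc_ge0; set q := simplex_dir c acc; set r := simplex_dir c _.
by set s := _ * _; clearbody q r s; lra.
Qed.

End Embeddings.

Theorem proposition6p17 (R : realType) (N n : nat) (M : manifold R n)
    (g : tensor_data M 2) (T : tensor_data M 3)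
    (f : M -> prob_manifold R N) (nabla0 : connection_data (prob_manifold R N)) :
  (0 < n)%N ->
  [set: M] !=set0 ->
  compact [set: M] ->
  kahler_statistical g T \/ cokahler_statistical g T ->
  isostatistical f g T (fisher R N) (amari_chentsov R N) ->
  is_levi_civita (fisher R N) nabla0 ->
  ~ totally_geodesic f nabla0.
Proof.
move=> n0 M0 cM _ [emb _ _] lc tg.
have [p _ pmin] : exists2 p : M, p \in [set: M] &
    forall q : M, q \in [set: M] -> prob_coord f ord0 p <= prob_coord f ord0 q.
  apply: compact_EVT_min => //; apply: continuous_subspaceT.
  exact: prob_coord_continuous.
apply: (totally_geodesic_no_min n0 emb lc tg (p := p) (c := ord0)) => q.
by apply: pmin; rewrite inE.
Qed.
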